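(* Let $G$ be a finite simple graph that contains neither $P_2+P_3$ nor $\overline{P_2+P_3}$ as an induced subgraph. If $G$ contains an induced $K_{2,3}$, then $\chi(G)\leq \omega(G)+3$.
   Context: $P_2+P_3$ is the disjoint union of a two-vertex path and a three-vertex path, $\overline{P_2+P_3}$ its complement; $K_{2,3}$ is the complete bipartite graph with parts of sizes 2 and 3. $\chi$, $\omega$ denote chromatic and clique number. *)

(* Defs.v *)
From mathcomp Require Import all_boot.

Set Implicit Arguments.
Unset Strict Implicit.
Unset Printing Implicit Defensive.

Record sgraph := SGraph {
  vertex :> finType;
  adj : rel vertex;
  adj_sym : symmetric adj;
  adj_irrefl : irreflexive adj
}.

Section Complement.
Variable G : sgraph.
Definition compl_adj : rel G := fun x y => (x != y) && ~~ adj x y.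
Lemma compl_adj_sym : symmetric compl_adj.
Proof. by move=> x y; rewrite /compl_adj eq_sym adj_sym. Qed.
Lemma compl_adj_irrefl : irreflexive compl_adj.
Proof. by move=> x; rewrite /compl_adj eqxx. Qed.
Definition compl : sgraph := SGraph compl_adj_sym compl_adj_irrefl.
End Complement.

Section DisjointUnion.
Variables G H : sgraph.
Definition disjoint_union_adj : rel (G + H)%type := fun u v =>
  match u, v with
  | inl x, inl y => adj x y
  | inr x, inr y => adj x y
  | _, _ => false
  end.
Lemma disjoint_union_adj_sym : symmetric disjoint_union_adj.
Proof. by case=> x [] y //=; apply: adj_sym. Qed.
Lemma disjoint_union_adj_irrefl : irreflexive disjoint_union_adj.
Proof. by case=> x /=; apply: adj_irrefl. Qed.
Definition disjoint_union : sgraph :=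
  SGraph disjoint_union_adj_sym disjoint_union_adj_irrefl.
End DisjointUnion.

(* [path_graph n] is the path on n vertices (not n edges). *)
Section PathGraph.
Variable n : nat.
Definition path_adj : rel 'I_n := fun i j => (i.+1 == j) || (j.+1 == i).
Lemma path_adj_sym : symmetric path_adj.
Proof. by move=> i j; rewrite /path_adj orbC. Qed.
Lemma path_adj_irrefl : irreflexive path_adj.
Proof. by move=> i; rewrite /path_adj orbb gtn_eqF. Qed.
Definition path_graph : sgraph := SGraph path_adj_sym path_adj_irrefl.
End PathGraph.

Section CompleteBipartite.
Variables m n : nat.
Definition complete_bipartite_adj : rel ('I_m + 'I_n)%type := fun u v =>
  match u, v with
  | inl _, inr _ | inr _, inl _ => true
  | _, _ => false
  end.
Lemma complete_bipartite_adj_sym : symmetric complete_bipartite_adj.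
Proof. by case=> x [] y. Qed.
Lemma complete_bipartite_adj_irrefl : irreflexive complete_bipartite_adj.
Proof. by case. Qed.
Definition complete_bipartite : sgraph :=
  SGraph complete_bipartite_adj_sym complete_bipartite_adj_irrefl.
End CompleteBipartite.

Definition has_induced (H G : sgraph) : Prop :=
  exists2 f : H -> G, injective f & forall x y, adj (f x) (f y) = adj x y.

Definition is_clique (G : sgraph) (A : {set G}) : bool :=
  [forall x in A, forall y in A, (x != y) ==> adj x y].

Definition clique_number (G : sgraph) : nat :=
  \max_(A : {set G} | is_clique A) #|A|.

Definition colorable (G : sgraph) (k : nat) : bool :=
  [exists f : {ffun G -> 'I_k}, [forall x, forall y, adj x y ==> (f x != f y)]].

Lemma ex_colorable (G : sgraph) : exists k, colorable G k.
Proof.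
exists #|G|; apply/existsP; exists [ffun x => enum_rank x].
apply/forallP=> x; apply/forallP=> y; apply/implyP=> xy; rewrite !ffunE.
by apply/eqP=> /enum_rank_inj e; rewrite e adj_irrefl in xy.
Qed.

Definition chromatic_number (G : sgraph) : nat := ex_minn (ex_colorable G).

(* Main.v *)
(** Let [x1, x2 | y1, y2, y3] induce the given [K_{2,3}] and let [T] be the set
    of vertices adjacent to all five.  A pair of nonadjacent vertices has a
    complete multipartite common neighbourhood, so [T] is complete multipartite;
    it contains a clique [T0] and has a colouring with [#|T0|] colours.  Classifying
    the other vertices by their adjacencies to the [K_{2,3}], [G - T] is always
    6-colourable, which suffices if [omega >= #|T0| + 3].  Otherwise
    [omega = #|T0| + 2], so no triangle is complete to [T0], and [G - T] is
    5-colourable.  Write [C1] (resp. [C2]) for the vertices adjacent to [x1]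
    but not [x2] (resp. to [x2] but not [x1]), and [Q] for those adjacent to
    neither and to exactly two of the [y]s.
    Vertices of [Q] are complete to [T], so [Q] is independent.  If [C1] and
    [C2] are independent, five colours are immediate.  If not, one of the three
    parts of [Q] is empty and the [K_{2,3}] has no twins outside itself.  If [C1]
    and [C2] both contained triangles, these would form a prism, and the
    adjacencies of [T0] to the prism are contradictory; so one of them, say
    [C1], is triangle-free, hence bipartite, and again five colours suffice. *)

Require Import Defs.
From mathcomp Require Import all_boot.

Set Implicit Arguments.
Unset Strict Implicit.
Unset Printing Implicit Defensive.

(** * Forbidden induced subgraphs as conditions on five vertices *)

Definition P2P3_free (G : sgraph) := forall a b c d f : G,
  adj a b -> adj c d -> adj d f -> c != f -> ~~ adj c f ->
  [|| adj a c, adj a d, adj a f, adj b c, adj b d | adj b f].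

(** The complement of $P_2+P_3$ is the join of two nonadjacent vertices with $K_1+K_2$: among the
    common neighbours of a nonadjacent pair, no vertex is isolated from an edge, that is,
    nonadjacent to both its ends. *)
Definition coP2P3_free (G : sgraph) := forall a b c d f : G,
  a != b -> ~~ adj a b -> adj c f -> ~~ adj d c -> ~~ adj d f ->
  ~~ [&& adj a c, adj a d, adj a f, adj b c, adj b d & adj b f].

Lemma adjC (G : sgraph) (u v : G) : adj u v = adj v u.
Proof. exact: adj_sym. Qed.

Lemma adj_neq (G : sgraph) (u v : G) : adj u v -> u != v.
Proof. by apply: contraTneq => ->; rewrite adj_irrefl. Qed.

(** The fifth value [f] is the default of [nth], reached at index 4. *)
Definition sum_pick (T : Type) (a b c d f : T) (u : 'I_2 + 'I_3) : T :=
  nth f [:: a; b; c; d] (match u with inl i => val i | inr i => (val i).+2 end).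

Lemma sum_pick_inj (T : eqType) (a b c d f : T) :
  uniq [:: a; b; c; d; f] -> injective (sum_pick a b c d f).
Proof.
move=> u5 u v; rewrite /sum_pick.
set m := (X in nth f _ X = _); set n := (X in _ = nth f _ X).
have E k : nth f [:: a; b; c; d] k = nth f [:: a; b; c; d; f] k.
  by case: k => [|[|[|[|[|k]]]]] //=; rewrite !nth_nil.
rewrite !E => /eqP; rewrite nth_uniq //.
- rewrite /m /n; case: (u) (v) => [i|i] [j|j] /eqP //=.
  + by move/val_inj->.
  + by move=> ij; have := ltn_ord i; rewrite ij.
  + by move=> ij; have := ltn_ord j; rewrite -ij.
  + by move=> [/val_inj->].
- by rewrite /m; case: (u) => i /=; [apply: leq_trans (ltn_ord i) _ | apply: (ltn_ord i)].
- by rewrite /n; case: (v) => i /=; [apply: leq_trans (ltn_ord i) _ | apply: (ltn_ord i)].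
Qed.

Lemma P2P3_freeP (G : sgraph) :
  ~ has_induced (disjoint_union (path_graph 2) (path_graph 3)) G ->
  P2P3_free G.
Proof.
move=> nG a b c d f ab cd df ncf /negPf cf; apply/negPn/negP.
rewrite !negb_or => /and5P[/negPf ac /negPf ad /negPf af /negPf bc].
case/andP=> /negPf bd /negPf bf.
apply: nG; exists (@sum_pick G a b c d f).
  have [[nab ncd] ndf] := (adj_neq ab, adj_neq cd, adj_neq df).
  (* A coincidence between the edge and the path would create an excluded adjacency. *)
  have nac : a != c by apply: contraFneq bc => <-; rewrite adjC.
  have nad : a != d by apply: contraFneq bd => <-; rewrite adjC.
  have naf : a != f by apply: contraFneq bf => <-; rewrite adjC.
  have nbc : b != c by apply: contraFneq ac => <-.
  have nbd : b != d by apply: contraFneq ad => <-.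
  have nbf : b != f by apply: contraFneq af => <-.
  by apply: sum_pick_inj; rewrite /= !inE !negb_or nab ncd ndf nac nad naf nbc
    nbd nbf ncf.
move=> [[[|[|//]] i]|[[|[|[|//]]] i]] [[[|[|//]] j]|[[|[|[|//]]] j]];
  rewrite /sum_pick /= ?adj_irrefl // ?(ab, cd, df, cf, ac, ad, af, bc, bd, bf)
    // adjC ?(ab, cd, df, cf, ac, ad, af, bc, bd, bf) //.
Qed.

Lemma coP2P3_freeP (G : sgraph) :
  ~ has_induced (compl (disjoint_union (path_graph 2) (path_graph 3))) G ->
  coP2P3_free G.
Proof.
move=> nG a b c d f nab /negPf ab cf /negPf dc /negPf df; apply/negP.
case/and5P=> ac ad af bc /andP[bd bf].
have cd : adj c d = false by rewrite adjC.
apply: nG; exists (@sum_pick G a b c d f).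
  have [[nac nad] naf] := (adj_neq ac, adj_neq ad, adj_neq af).
  have [[nbc nbd] nbf] := (adj_neq bc, adj_neq bd, adj_neq bf).
  have ncf := adj_neq cf.
  have ncd : c != d by apply: contraFneq df => <-.
  have ndf : d != f by apply: contraFneq dc => ->; rewrite adjC.
  by apply: sum_pick_inj; rewrite /= !inE !negb_or nab ncd ndf nac nad naf nbc
    nbd nbf ncf.
move=> [[[|[|//]] i]|[[|[|[|//]]] i]] [[[|[|//]] j]|[[|[|[|//]]] j]];
  rewrite /sum_pick /= ?adj_irrefl /compl_adj -?val_eqE /= ?andbF ?andbT //;
  rewrite ?(ab, cd, df, cf, ac, ad, af, bc, bd, bf) // adjC;
  by rewrite ?(ab, cd, df, cf, ac, ad, af, bc, bd, bf).
Qed.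

(** * Vertex types and colourings checked by enumeration *)

(* The type of a vertex [v] relative to [K = [:: x1; x2; y1; y2; y3]]: its
   position in [K] (5 when [v] is not in [K]) and its adjacencies to [K]. *)
Definition vtype := (nat * seq bool)%type.
Definition bit (s : vtype) (i : nat) : bool := nth false s.2 i.

Definition ypairs := [:: (2, 3); (2, 4); (3, 4)].
Definition yopairs := ypairs ++ [seq (p.2, p.1) | p <- ypairs].

(** Besides the rows of [K] itself, the clauses record that a common neighbour of two opposite
    vertices of a 4-cycle of [K] is adjacent to both or to neither of the other two. *)
Definition valid (s : vtype) :=
  [&& (s.1 < 2) ==> (s.2 == [:: false; false; true; true; true]),
      (2 <= s.1 < 5) ==> (s.2 == [:: true; true; false; false; false]),
      all (fun p => [&& bit s 0, bit s 1 & bit s p.1] ==> bit s p.2) yopairs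
    & all (fun p => bit s p.1 && bit s p.2 ==> (bit s 0 == bit s 1)) ypairs].

Definition dominating (s : vtype) := all id s.2.

(* Necessary conditions on the types of adjacent vertices: the edge meets every
   induced [P_3] of [K], and the common neighbourhoods of a vertex and a vertex
   of [K], or of two vertices of [K], are complete multipartite. *)
Definition compat (s t : vtype) :=
  [&& (s.1 < 5) ==> bit t s.1,
      all (fun i => all (fun p =>
        [|| bit s i, bit s p.1, bit s p.2, bit t i, bit t p.1 | bit t p.2])
        ypairs) [:: 0; 1],
      all (fun j =>
        [|| bit s 0, bit s 1, bit s j, bit t 0, bit t 1 | bit t j])
        [:: 2; 3; 4],
      all (fun i => all (fun p =>
        [&& s.1 != i, ~~ bit s i, bit s p.1, bit s p.2, bit t i & bit t p.1]
          ==> bit t p.2) yopairs) [:: 0; 1],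
      all (fun j => all (fun p =>
        [&& s.1 != j, ~~ bit s j, bit s p.1, bit s p.2, bit t j & bit t p.1]
          ==> bit t p.2) [:: (0, 1); (1, 0)]) [:: 2; 3; 4],
      all (fun i => all (fun p =>
        [&& bit s p.1, bit s p.2, bit t p.1 & bit t p.2]
          ==> bit s i || bit t i) ypairs) [:: 0; 1]
    & all (fun j =>
        [&& bit s 0, bit s 1, bit t 0 & bit t 1]
          ==> bit s j || bit t j) [:: 2; 3; 4]].

Fixpoint cube n : seq (seq bool) :=
  if n is m.+1 then [seq b :: s | b <- [:: true; false], s <- cube m]
  else [:: [::]].

Lemma mem_cube (s : seq bool) : s \in cube (size s).
Proof.
elim: s => // b s IHs.
by apply/allpairsP; exists (b, s); split=> //; case: b.
Qed.

Definition types : seq vtype :=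
  [seq s <- [seq (i, b) | i <- iota 0 6, b <- cube 5] |
    valid s && ~~ dominating s].

(** The bit [h] is information that the type does not determine; [ok] restricts the pairs of types
    to be separated. *)
Definition proper_on (c : bool -> vtype -> nat)
    (ok : bool -> bool -> rel vtype) (n : nat) : bool :=
  all (fun h => all (fun s => (c h s < n) &&
    all (fun h' => all (fun t =>
      [&& compat s t, compat t s & ok h h' s t] ==> (c h s != c h' t)) types)
      [:: true; false]) types) [:: true; false].

Definition typeC1 (s : vtype) := bit s 0 && ~~ bit s 1.
Definition typeC2 (s : vtype) := bit s 1 && ~~ bit s 0.
Definition typeQ (s : vtype) :=
  [&& ~~ bit s 0, ~~ bit s 1 & count id s.2 == 2].

Definition color6 (h : bool) (s : vtype) : nat :=
  match s with
  | (0, _) => 3 | (1, _) => 0 | (2, _) => 1 | (3, _) => 2 | (4, _) => 4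
  | (_, [:: true; false; true; false; false])
  | (_, [:: false; false; true; false; false])
  | (_, [:: false; false; true; true; false]) => 0
  | (_, [:: true; false; false; true; false])
  | (_, [:: false; false; false; true; false])
  | (_, [:: false; false; false; true; true]) => 1
  | (_, [:: true; false; false; false; true])
  | (_, [:: false; false; false; false; true])
  | (_, [:: true; false; false; false; false])
  | (_, [:: false; false; false; false; false]) => 2
  | (_, [:: false; true; true; false; false])
  | (_, [:: false; true; false; false; false]) => 3
  | (_, [:: false; true; false; true; false])
  | (_, [:: true; true; false; false; false]) => 4
  | _ => 5
  end.

Lemma color6_proper : proper_on color6 (fun _ _ _ _ => true) 6.
Proof. by vm_compute. Qed.

Definition color5 (h : bool) (s : vtype) : nat :=
  if bit s 0 then (if bit s 1 then 1 else 2)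
  else if bit s 1 then 3 else if 1 < count id s.2 then 0 else 4.

Definition ok5 (h h' : bool) (s t : vtype) :=
  [&& ~~ (typeQ s && typeQ t), ~~ (typeC1 s && typeC1 t)
    & ~~ (typeC2 s && typeC2 t)].

Lemma color5_proper : proper_on color5 ok5 5.
Proof. by vm_compute. Qed.

(* Here [h] is a proper 2-colouring of [C1]. *)
Definition color5h (h : bool) (s : vtype) : nat :=
  match s with
  | (0, _) => 2 | (1, _) => 0 | (2, _) => 3 | (3, _) => 4 | (4, _) => 3
  | (_, [:: true; _; _; _; _]) => if h then 0 else 1
  | (_, [:: false; true; true; false; false])
  | (_, [:: false; false; true; false; false])
  | (_, [:: false; false; true; true; false])
  | (_, [:: false; false; true; false; true]) => 2
  | (_, [:: false; true; false; true; false])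
  | (_, [:: false; false; false; true; false]) => 3
  | _ => 4
  end.

(** The excluded rows are those of twins of the [y]s, of twins of the [x]s and of vertices adjacent
    to exactly [y2] and [y3]. *)
Definition type5h (s : vtype) :=
  [&& (s.1 == 5) ==> (s.2 != [:: true; true; false; false; false]),
      (s.1 == 5) ==> (s.2 != [:: false; false; true; true; true])
    & s.2 != [:: false; false; false; true; true]].

Definition ok5h (h h' : bool) (s t : vtype) :=
  [&& ~~ (typeQ s && typeQ t), ~~ [&& typeC1 s, typeC1 t & h == h'],
      type5h s & type5h t].

Lemma color5h_proper : proper_on color5h ok5h 5.
Proof. by vm_compute. Qed.

(** * Labelled $K_{2,3}$, with the [y]s in a list open to permutation *)

Definition K23 (G : sgraph) (x1 x2 : G) (Y : seq G) : bool :=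
  [&& x1 != x2, ~~ adj x1 x2, all (adj x1) Y, all (adj x2) Y, uniq Y
    & all2rel (fun y y' => ~~ adj y y') Y].

Definition induced_P3 (G : sgraph) (a b c : G) : bool :=
  [&& adj b a, adj b c, a != c & ~~ adj a c].

Lemma induced_P3C (G : sgraph) (a b c : G) :
  induced_P3 a b c = induced_P3 c b a.
Proof. by rewrite /induced_P3 andbCA eq_sym [adj a c]adjC. Qed.

Definition inC (G : sgraph) (x x' v : G) : bool := adj v x && ~~ adj v x'.

Definition inCy (G : sgraph) (x x' a b c v : G) : bool :=
  [&& adj v x, ~~ adj v x', adj v a, ~~ adj v b & ~~ adj v c].

Definition inQ (G : sgraph) (x x' : G) (Y : seq G) (v : G) : bool :=
  [&& ~~ adj v x, ~~ adj v x' & count (adj v) Y == 2].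

Lemma perm_K23 (G : sgraph) (x x' : G) (Y Y' : seq G) :
  perm_eq Y Y' -> K23 x x' Y = K23 x x' Y'.
Proof.
move=> p; rewrite /K23 !(perm_all _ p) (perm_uniq p) (eq_allrel_meml _ _ (perm_mem p)).
by rewrite (eq_allrel_memr _ _ (perm_mem p)).
Qed.

Lemma K23C (G : sgraph) (x x' : G) (Y : seq G) : K23 x x' Y -> K23 x' x Y.
Proof. by case/and5P=> nx xx Y1 Y2; rewrite /K23 eq_sym nx adjC xx Y1 Y2. Qed.

Section Free.

Local Ltac adj_cases :=
  repeat match goal with |- context [adj ?a ?b] => case: (adj a b) => //= end.

Variable G : sgraph.
Hypotheses (PF : P2P3_free G) (coPF : coP2P3_free G).

(** * Consequences of the two exclusions around an induced path *)

Lemma edge_meets_P3 (a b c u v : G) : induced_P3 a b c -> adj u v ->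
  [|| adj u b, adj u a, adj u c, adj v b, adj v a | adj v c].
Proof.
case/and4P=> ba bc nac ac uv.
have := PF uv (etrans (adjC _ _) ba) bc nac ac.
by do ![case: (adj _ _) => //=].
Qed.

(** Among the common neighbours of [u] and [b], the vertex [c] is not isolated from the edge
    [va]. *)
Lemma nonadj_common_P3 (a b c u v : G) : induced_P3 a b c -> adj u v ->
  u != b -> ~~ adj u b -> adj u a -> adj u c -> adj v b -> adj v a -> adj v c.
Proof.
case/and4P=> ba bc nac ac uv nub ub ua uc vb va; apply: contraLR (uv) => vc.
have := coPF (c := v) (d := c) (f := a) nub ub va.
rewrite [adj c v]adjC [adj c a]adjC vc ac ua uc ba bc [adj b v]adjC vb !andbT.
by move/(_ isT isT); apply: contra.
Qed.

(** Here the nonadjacent pair is [a], [c], and [b] is not isolated from the edge [uv]. *)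
Lemma ends_common_P3 (a b c u v : G) : induced_P3 a b c -> adj u v ->
  adj u a -> adj u c -> adj v a -> adj v c -> adj u b || adj v b.
Proof.
case/and4P=> ba bc nac ac uv ua uc va vc; apply: contraLR (uv).
rewrite negb_or => /andP[ub vb].
have := coPF (c := u) (d := b) (f := v) nac ac; rewrite uv.
rewrite [adj b u]adjC [adj b v]adjC ub vb ![adj a _]adjC ![adj c _]adjC.
by rewrite ua uc va vc ba bc => /(_ isT isT isT).
Qed.

(** For the pair [a], [b], the vertex [d] is not isolated from the edge [vc]. *)
Lemma C4_neighbor (a b c d v : G) : induced_P3 a c b -> induced_P3 a d b ->
  c != d -> ~~ adj c d -> adj v a -> adj v b -> adj v c -> adj v d.
Proof.
case/and4P=> ca cb nab ab /and4P[da db _ _] ncd cd va vb vc.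
apply: contraLR (va) => vd.
have := coPF (c := v) (d := d) (f := c) nab ab vc.
rewrite [adj d v]adjC [adj d c]adjC vd cd ![adj a _]adjC ![adj b _]adjC.
by rewrite va vb ca cb da db => /(_ isT isT).
Qed.

Section Bipartite.

Variables x1 x2 y1 y2 y3 : G.
Hypothesis hK : K23 x1 x2 [:: y1; y2; y3].

Let K := [:: x1; x2; y1; y2; y3].
Let k i := nth x1 K i.

Definition ty (v : G) : vtype :=
  (index v [:: x1; x2; y1; y2; y3], [seq adj v z | z <- [:: x1; x2; y1; y2; y3]]).

Lemma K23E : [/\ x1 != x2, ~~ adj x1 x2,
   [/\ adj x1 y1, adj x1 y2 & adj x1 y3], [/\ adj x2 y1, adj x2 y2 & adj x2 y3]
 & [/\ y1 != y2, y1 != y3 & y2 != y3]] /\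
 [/\ ~~ adj y1 y2, ~~ adj y1 y3 & ~~ adj y2 y3].
Proof.
move: hK; rewrite /K23 /= !inE !negb_or /allrel /= !andbT !adj_irrefl /=.
case/and5P=> -> -> /and3P[-> -> ->] /and3P[-> -> ->].
case/andP=> /andP[/andP[-> ->] ->].
by case/and3P=> /andP[-> ->] /andP[_ ->] _.
Qed.

Lemma P3_yxy i p : i \in [:: 0; 1] -> p \in yopairs ->
  induced_P3 (k p.1) (k i) (k p.2).
Proof.
have [[_ _ [a1 a2 a3] [b1 b2 b3] [n12 n13 n23]] [c12 c13 c23]] := K23E.
rewrite !inE => /orP[] /eqP->;
  do ![case/predU1P=> [->|] | move/eqP->];
  rewrite /induced_P3 /k /= ?(a1, a2, a3, b1, b2, b3) /= ?n12 ?n13 ?n23 //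
   1?eq_sym 1?adjC ?n12 ?n13 ?n23 //.
Qed.

Lemma P3_xyx j : j \in [:: 2; 3; 4] -> induced_P3 (k 0) (k j) (k 1).
Proof.
have [[n12 c12 [a1 a2 a3] [b1 b2 b3] _] _] := K23E.
rewrite !inE; do ![case/predU1P=> [->|] | move/eqP->];
  by rewrite /induced_P3 /k /= ?[adj y1 _]adjC ?[adj y2 _]adjC ?[adj y3 _]adjC n12 c12
     ?(a1, a2, a3, b1, b2, b3).
Qed.

Lemma bitE v i : i < 5 -> bit (ty v) i = adj v (k i).
Proof. by case: i => [|[|[|[|[|]]]]]. Qed.

Lemma K_uniq : uniq K.
Proof.
have [[n _ [a1 a2 a3] [b1 b2 b3] [n12 n13 n23]] _] := K23E.
by rewrite /= !inE !negb_or n n12 n13 n23 !adj_neq.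
Qed.

Lemma tag_neq v i : i < 5 -> (ty v).1 != i -> v != k i.
Proof.
move=> i5; apply: contra => /eqP->; apply/eqP.
exact: (@index_uniq _ x1 i K i5 K_uniq).
Qed.

Lemma yopairs_lt p : p \in yopairs -> (p.1 < 5) && (p.2 < 5).
Proof. by move: p; apply/allP. Qed.

Lemma ypairs_yopairs p : p \in ypairs -> p \in yopairs.
Proof. by rewrite mem_cat => ->. Qed.

Lemma compat_adj (u v : G) : adj u v -> compat (ty u) (ty v).
Proof.
move=> uv; have lt2 i : i \in [:: 0; 1] -> i < 5 by case: i => [|[]].
have lt3 j : j \in [:: 2; 3; 4] -> j < 5 by case: j => [|[|[|[|[]]]]].
apply/and5P; split; [ | | | | apply/and3P; split].
- apply/implyP=> lt5; rewrite bitE //.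
  by rewrite [k _]nth_index 1?adjC // -index_mem.
- apply/allP=> i iX; apply/allP=> p /ypairs_yopairs pY.
  have /andP[p1 p2] := yopairs_lt pY; rewrite !bitE ?(lt2 _ iX) //.
  exact: edge_meets_P3 (P3_yxy iX pY) uv.
- apply/allP=> j jY; have := edge_meets_P3 (P3_xyx jY) uv.
  by rewrite !bitE ?(lt3 _ jY) //; do ![case: (adj _ _) => //=].
- apply/allP=> i iX; apply/allP=> p pY.
  have /andP[p1 p2] := yopairs_lt pY; rewrite !bitE ?(lt2 _ iX) //.
  apply/implyP=> /and5P[/(tag_neq (lt2 _ iX)) ni ui u1 u2 /andP[vi v1]].
  exact: nonadj_common_P3 (P3_yxy iX pY) uv ni ui u1 u2 vi v1.
- apply/allP=> j jY; have P := P3_xyx jY.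
  apply/and3P; split=> //; rewrite !bitE ?(lt3 _ jY) //; apply/implyP;
    move=> /and5P[/(tag_neq (lt3 _ jY)) nj uj u1 u2 /andP[vj v1]].
    exact: nonadj_common_P3 P uv nj uj u1 u2 vj v1.
  rewrite induced_P3C in P; exact: nonadj_common_P3 P uv nj uj u1 u2 vj v1.
- apply/allP=> i iX; apply/allP=> p /ypairs_yopairs pY.
  have /andP[p1 p2] := yopairs_lt pY; rewrite !bitE ?(lt2 _ iX) //.
  apply/implyP=> /and4P[u1 u2 v1 v2].
  exact: ends_common_P3 (P3_yxy iX pY) uv u1 u2 v1 v2.
- apply/allP=> j jY; rewrite !bitE ?(lt3 _ jY) //.
  apply/implyP=> /and4P[u1 u2 v1 v2].
  exact: ends_common_P3 (P3_xyx jY) uv u1 u2 v1 v2.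
Qed.

Lemma valid_ty (v : G) : valid (ty v).
Proof.
have [[nx /negPf cx [a1 a2 a3] [b1 b2 b3] [n12 n13 n23]] [c12 c13 c23]] := K23E.
have C p : p \in yopairs -> (k p.1 != k p.2) && ~~ adj (k p.1) (k p.2).
  by move=> pY; case/and4P: (@P3_yxy 0 p isT pY) => _ _ -> ->.
have Yi j p : p \in yopairs -> j \in [:: p.1; p.2] -> j \in [:: 2; 3; 4].
  by move=> pY; move: j; apply/allP; move: p pY; apply/allP.
apply/and4P; split.
- apply/implyP; rewrite /ty /=; have [<-|_] := eqVneq x1 v.
    by rewrite a1 a2 a3 cx adj_irrefl.
  have [<-|_] := eqVneq x2 v; first by rewrite b1 b2 b3 adjC cx adj_irrefl.
  by [].
- apply/implyP=> /= /andP[le2 lt5].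
  have : v \in K by rewrite -index_mem.
  move: le2; rewrite 4!inE [x1 == v]eq_sym [x2 == v]eq_sym.
  case: eqP => //= _; case: eqP => //= _ _; rewrite !inE.
  have S (u w : G) b : adj u w = b -> adj w u = b by rewrite adjC.
  move: c12 c13 c23 => /negPf c12 /negPf c13 /negPf c23.
  by case/or3P=> /eqP->; rewrite (S _ _ _ a1, S _ _ _ a2, S _ _ _ a3)
    (S _ _ _ b1, S _ _ _ b2, S _ _ _ b3) adj_irrefl ?(c12, c13, c23)
    ?(S _ _ _ c12, S _ _ _ c13, S _ _ _ c23).
- apply/allP=> p pY; have /andP[p1 p2] := yopairs_lt pY; rewrite !bitE //.
  have /andP[n c] := C p pY.
  apply/implyP=> /and3P[v0 v1 vp]; apply: C4_neighbor n c v0 v1 vp.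
    by apply: P3_xyx (Yi _ p pY _); rewrite inE eqxx.
  by apply: P3_xyx (Yi _ p pY _); rewrite !inE eqxx orbT.
- apply/allP=> p /ypairs_yopairs pY; have /andP[p1 p2] := yopairs_lt pY.
  rewrite !bitE //; apply/implyP=> /andP[v1 v2].
  have P0 := @P3_yxy 0 p isT pY; have P1 := @P3_yxy 1 p isT pY.
  apply/eqP; apply/idP/idP; apply: C4_neighbor v1 v2 => //; rewrite /k //= ?cx //.
    by rewrite eq_sym.
  by rewrite adjC cx.
Qed.

Lemma dominatingE v : dominating (ty v) = all (adj v) K.
Proof. by rewrite /dominating /= !andbT. Qed.

Lemma mem_types v : ~~ all (adj v) K -> ty v \in types.
Proof.
rewrite -dominatingE => nT; rewrite mem_filter valid_ty nT !andTb.
apply/allpairsP; exists (ty v); split=> //.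
  by rewrite mem_iota ltnS (index_size v K).
exact: (mem_cube (ty v).2).
Qed.

(** Transfers the check on types to vertices; an edge yields [compat] in both orders, which matters
    as [compat] is not symmetric. *)
Lemma proper_onP c ok n (h : G -> bool) : proper_on c ok n ->
    (forall u v, adj u v -> ok (h u) (h v) (ty u) (ty v)) ->
  exists f : G -> nat, forall u v, ~~ all (adj u) K -> ~~ all (adj v) K ->
    (f u < n) /\ (adj u v -> f u != f v).
Proof.
move=> cP okP; exists (fun v => c (h v) (ty v)) => u v /mem_types uT /mem_types vT.
have hb (b : bool) : b \in [:: true; false] by case: b.
have /andP[ltn /allP/(_ _ (hb (h v)))/allP/(_ _ vT)/implyP P] :=
  allP (allP cP _ (hb (h u))) _ uT.
split=> // uv; apply: P; rewrite compat_adj // compat_adj 1?adjC //.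
exact: okP.
Qed.

(** * Edges and bipartiteness of [C1] *)

Local Notation inC1 := (inC x1 x2).

(** By the fourth clause of [valid], two neighbours among the [y]s would force the same adjacency to
    [x1] and [x2]. *)
Lemma C1_row (v : G) : inC1 v ->
  [&& ~~ (adj v y1 && adj v y2), ~~ (adj v y1 && adj v y3)
    & ~~ (adj v y2 && adj v y3)].
Proof.
case/andP=> v1 /negPf v2; have := valid_ty v.
rewrite /valid /bit /= v1 v2 => /and4P[_ _ _].
by do 3![case: (adj v _) => //].
Qed.

(** Neither end sees [x2], so the edge must see a [y] of each path [yi x2 yj], hence at least two
    [y]s; by [C1_row] each end sees at most one. *)
Lemma C1_edge (u v : G) : inC1 u -> inC1 v -> adj u v ->
  [&& (adj u y1 + adj u y2 + adj u y3 == 1), (adj v y1 + adj v y2 + adj v y3 == 1),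
      ~~ (adj u y1 && adj v y1), ~~ (adj u y2 && adj v y2)
    & ~~ (adj u y3 && adj v y3)].
Proof.
move=> uC vC uv; have := C1_row uC; have := C1_row vC.
case/andP: uC vC => u1 /negPf u2 /andP[v1 /negPf v2].
have /and4P[_ + _ _] := compat_adj uv; rewrite /bit /= u1 u2 v1 v2 /=.
by adj_cases.
Qed.

(** Equal rows make [v u w] an induced path. Each edge [x2 y] must meet it, so [u] and [v] would see
    all three [y]s, against [C1_row]. *)
Lemma C1_matching (u v w : G) : inC1 u -> inC1 v -> inC1 w ->
  adj u v -> adj u w -> v != w ->
  ~~ [&& adj v y1 == adj w y1, adj v y2 == adj w y2 & adj v y3 == adj w y3].
Proof.
move=> uC vC wC uv uw nvw; apply/negP=> /and3P[/eqP e1 /eqP e2 /eqP e3].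
have vw : ~~ adj v w.
  apply/negP=> /(C1_edge vC wC); rewrite e1 e2 e3.
  by adj_cases.
have P : induced_P3 v u w by rewrite /induced_P3 uv uw nvw.
have [[_ _ _ [b1 b2 b3] _] _] := K23E.
have E y : adj x2 y -> adj v y = adj w y -> adj u y || adj v y.
  move=> /(edge_meets_P3 P); case/andP: uC vC wC => _ /negPf u2.
  case/andP=> _ /negPf v2 /andP[_ /negPf w2].
  rewrite ![adj x2 _]adjC ![adj y _]adjC u2 v2 w2 /= => H e.
  move: H; rewrite e.
  by case: (adj u y); case: (adj w y).
have := C1_row uC; have := C1_row vC; have := E _ b1 e1; have := E _ b2 e2.
have := E _ b3 e3.
by adj_cases.
Qed.

(** Label a non-isolated vertex of [C1] by its unique neighbour among the [y]s. The labels of a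
    vertex and of its neighbours in [C1] are distinct, so degrees are at most two. *)
Lemma C1_bipartite :
    (forall u v w, inC1 u -> inC1 v -> inC1 w ->
       adj u v -> adj u w -> ~~ adj v w) ->
  exists h : G -> bool,
    forall u v, inC1 u -> inC1 v -> adj u v -> h u != h v.
Proof.
move=> noT.
case: (boolP [exists p, exists q, exists r,
    [&& inC1 p, inC1 q, inC1 r & induced_P3 p q r]]); last first.
  move=> noP; have uniq_nbr u v w : inC1 u -> inC1 v -> inC1 w ->
      adj u v -> adj u w -> v = w.
    move=> uC vC wC uv uw; apply: contraNeq noP => nvw.
    apply/existsP; exists v; apply/existsP; exists u; apply/existsP; exists w.
    by rewrite uC vC wC /induced_P3 uv uw nvw (noT u).
  (* [C1] induces a matching here: each edge is split by the order of its ends in the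
     enumeration. *)
  exists (fun u => [exists v, [&& inC1 v, adj u v & enum_rank u < enum_rank v]]).
  have H u v : inC1 u -> inC1 v -> adj u v ->
    [exists v, [&& inC1 v, adj u v & enum_rank u < enum_rank v]] =
    (enum_rank u < enum_rank v).
    move=> uC vC uv; apply/existsP/idP => [[w /and3P[wC uw]]|lt].
      by rewrite (uniq_nbr u v w).
    by exists v; rewrite vC uv.
  move=> u v uC vC uv; rewrite (H u v) // (H v u) 1?adjC //.
  case: ltngtP => // /val_inj/enum_rank_inj e.
  by rewrite e adj_irrefl in uv.
case/existsP=> p /existsP[q /existsP[r /and4P[pC qC rC pqr]]].
(* One class consists of the neighbours of the ends of an induced path [p q r]. *)
exists (fun u => adj u p || adj u r).
have /and4P[qp qr npr pr] := pqr.
have pq : adj p q by rewrite adjC.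
(* A third neighbour of [q] would need a fourth label. *)
have nbr_q u : inC1 u -> adj q u -> (u == p) || (u == r).
  move=> uC qu; apply/negPn/negP; rewrite negb_or => /andP[nup nur].
  have := C1_edge qC pC qp; have := C1_edge qC rC qr; have := C1_edge qC uC qu.
  have := C1_matching qC pC rC qp qr npr; have := C1_matching qC uC pC qu qp nup.
  by have := C1_matching qC uC rC qu qr nur; clear -k; adj_cases.
(* Unless [u = q], the cycle [p q r v u] gives [u] and [r] the same label, while [C1_matching] at
   [v] separates them. *)
have cross u v : inC1 u -> inC1 v -> adj u v -> adj u p -> adj v r -> False.
  move=> uC vC uv up vr; have vu : adj v u by rewrite adjC.
  have pu : adj p u by rewrite adjC.
  have [uq|nuq] := eqVneq u q.
    have vq : adj v q by rewrite -uq.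
    by have := noT v q r vC qC rC vq vr; rewrite qr.
  have nur : u != r by apply: contraNneq pr => <-.
  have := C1_edge pC qC pq; have := C1_edge qC rC qr; have := C1_edge pC uC pu.
  have := C1_matching qC pC rC qp qr npr; have := C1_matching pC uC qC pu pq nuq.
  by have := C1_matching vC uC rC vu vr nur; clear -k; adj_cases.
have indep0 u v : inC1 u -> inC1 v -> adj u v -> adj u q ->
    ~~ adj v p -> ~~ adj v r -> False.
  move=> uC vC uv; rewrite adjC => /(nbr_q _ uC)/orP[]/eqP e;
    by rewrite -e [adj v u]adjC uv.
move=> u v uC vC uv; have vu : adj v u by rewrite adjC.
have noT' w : inC1 w -> adj u w -> adj v w -> False.
  by move=> wC uw; apply/negP/(noT u).
case up: (adj u p); case ur: (adj u r); case vp: (adj v p); case vr: (adj v r) => //=;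
  try by [case: (noT' p) | case: (noT' r) | case: (cross u v) | case: (cross v u)].
(* An edge inside the other class must see [q]; its end adjacent to [q] is [p] or [r], which the
   other end then sees. *)
have := edge_meets_P3 pqr uv; rewrite up ur vp vr /= !orbF => /orP[uq|vq].
  by case: (indep0 u v) => //; rewrite ?vp ?vr.
by case: (indep0 v u) => //; rewrite ?up ?ur.
Qed.

Lemma C1_edgeP (u v : G) : inC1 u -> inC1 v -> adj u v ->
  exists a b c, [/\ perm_eq [:: a; b; c] [:: y1; y2; y3],
    inCy x1 x2 a b c u & inCy x1 x2 b a c v].
Proof.
move=> uC vC uv; have := C1_edge uC vC uv; rewrite /inCy.
case/andP: uC vC => -> -> /andP[-> ->] /=.
have p123 := perm_refl [:: y1; y2; y3].
have p213 : perm_eq [:: y2; y1; y3] [:: y1; y2; y3].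
  by apply/permPl; apply: (perm_catCA [:: y2] [:: y1] [:: y3]).
have p132 : perm_eq [:: y1; y3; y2] [:: y1; y2; y3].
  by rewrite perm_cons; apply/permPl; apply: (perm_catC [:: y3] [:: y2]).
have p231 : perm_eq [:: y2; y3; y1] [:: y1; y2; y3].
  by apply/permPl; apply: (perm_catC [:: y2; y3] [:: y1]).
have p312 : perm_eq [:: y3; y1; y2] [:: y1; y2; y3].
  by apply/permPl; apply: (perm_catC [:: y3] [:: y1; y2]).
have p321 : perm_eq [:: y3; y2; y1] [:: y1; y2; y3].
  apply: perm_trans p312; rewrite perm_cons.
  by apply/permPl; apply: (perm_catC [:: y2] [:: y1]).
case u1: (adj u y1); case u2: (adj u y2); case u3: (adj u y3) => //=;
case v1: (adj v y1); case v2: (adj v y2); case v3: (adj v y3) => //= _;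
  by [exists y1, y2, y3; rewrite u1 u2 u3 v1 v2 v3
     |exists y1, y3, y2; rewrite u1 u2 u3 v1 v2 v3
     |exists y2, y1, y3; rewrite u1 u2 u3 v1 v2 v3
     |exists y2, y3, y1; rewrite u1 u2 u3 v1 v2 v3
     |exists y3, y1, y2; rewrite u1 u2 u3 v1 v2 v3
     |exists y3, y2, y1; rewrite u1 u2 u3 v1 v2 v3].
Qed.

(** Three pairwise distinct labels exhaust the [y]s. *)
Lemma C1_triangleP (u v w : G) : inC1 u -> inC1 v -> inC1 w ->
  adj u v -> adj u w -> adj v w ->
  exists p q r, [/\ inCy x1 x2 y1 y2 y3 p, inCy x1 x2 y2 y1 y3 q,
    inCy x1 x2 y3 y1 y2 r & [/\ adj p q, adj p r & adj q r]].
Proof.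
move=> uC vC wC uv uw vw.
have := C1_edge uC vC uv; have := C1_edge uC wC uw; have := C1_edge vC wC vw.
have [vu [wu wv]] : adj v u /\ (adj w u /\ adj w v) by rewrite ![adj _ u]adjC [adj w v]adjC.
rewrite /inCy; case/andP: uC vC wC => Eu1 Eu2 /andP[Ev1 Ev2] /andP[Ew1 Ew2].
case u1: (adj u y1); case u2: (adj u y2); case u3: (adj u y3) => //=;
case v1: (adj v y1); case v2: (adj v y2); case v3: (adj v y3) => //=;
case w1: (adj w y1); case w2: (adj w y2); case w3: (adj w y3) => //= _ _ _;
  have E := (Eu1, Eu2, Ev1, Ev2, Ew1, Ew2, (u1, u2, u3), (v1, v2, v3), (w1, w2, w3));
  by [exists u, v, w; split; rewrite ?E
     |exists u, w, v; split; rewrite ?E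
     |exists v, u, w; split; rewrite ?E
     |exists v, w, u; split; rewrite ?E
     |exists w, u, v; split; rewrite ?E
     |exists w, v, u; split; rewrite ?E].
Qed.

Lemma color6_ex : exists f : G -> nat, forall u v,
  ~~ all (adj u) K -> ~~ all (adj v) K -> (f u < 6) /\ (adj u v -> f u != f v).
Proof. exact: (proper_onP (h := xpredT) color6_proper). Qed.

Lemma typeQE v : typeQ (ty v) = inQ x1 x2 [:: y1; y2; y3] v.
Proof.
by rewrite /typeQ /inQ /bit /=; case: (adj v x1) => //; case: (adj v x2).
Qed.

Lemma color5_ex :
    (forall u v, inQ x1 x2 [:: y1; y2; y3] u -> inQ x1 x2 [:: y1; y2; y3] v ->
       ~~ adj u v) ->
    (forall u v, inC x1 x2 u -> inC x1 x2 v -> ~~ adj u v) ->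
    (forall u v, inC x2 x1 u -> inC x2 x1 v -> ~~ adj u v) ->
  exists f : G -> nat, forall u v,
  ~~ all (adj u) K -> ~~ all (adj v) K -> (f u < 5) /\ (adj u v -> f u != f v).
Proof.
move=> hQ h1 h2; apply: (proper_onP (h := xpredT) color5_proper) => u v uv.
rewrite /ok5 !typeQE; apply/and3P; split; apply: contraL uv => /andP[].
- exact: hQ.
- exact: h1.
- exact: h2.
Qed.

Lemma color5h_ex (h : G -> bool) :
    (forall u v, inC x1 x2 u -> inC x1 x2 v -> adj u v -> h u != h v) ->
    (forall u v, inQ x1 x2 [:: y1; y2; y3] u -> inQ x1 x2 [:: y1; y2; y3] v ->
       ~~ adj u v) ->
    (forall w, w \notin K -> ~~ [&& adj w x1, adj w x2,
       ~~ adj w y1, ~~ adj w y2 & ~~ adj w y3]) ->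
    (forall w, w \notin K -> ~~ [&& ~~ adj w x1, ~~ adj w x2,
       adj w y1, adj w y2 & adj w y3]) ->
    (forall w, ~~ [&& inQ x1 x2 [:: y1; y2; y3] w, adj w y2 & adj w y3]) ->
  exists f : G -> nat, forall u v,
  ~~ all (adj u) K -> ~~ all (adj v) K -> (f u < 5) /\ (adj u v -> f u != f v).
Proof.
move=> hh hQ hE hX hQ23; apply: (proper_onP (h := h) color5h_proper) => u v uv.
have T w : type5h (ty w).
  apply/and3P; split.
  - apply/implyP=> w5; apply: contra (hE w _); last first.
      by rewrite -index_mem (eqP w5 : index w K = 5).
    by case/eqP=> -> -> -> -> ->.
  - apply/implyP=> w5; apply: contra (hX w _); last first.
      by rewrite -index_mem (eqP w5 : index w K = 5).
    by case/eqP=> -> -> -> -> ->.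
  - by apply: contra (hQ23 w); rewrite /inQ /=; case/eqP=> -> -> -> -> ->.
rewrite /ok5h !typeQE !T !andbT; apply/andP; split; apply/negP.
  by case/andP=> uQ vQ; have := hQ u v uQ vQ; rewrite uv.
by case/and3P=> uC vC; apply/negP; apply: hh.
Qed.

End Bipartite.

(** * Restrictions imposed by an edge or a triangle of [C1] *)

Section Structure.

Variables x x' a b c : G.
Hypothesis hK : K23 x x' [:: a; b; c].

Local Notation dom t := (all (adj t) [:: x; x'; a; b; c]).

(** Neither [p] nor [q] can see such a twin [w] of the [y]s, so the edge [pq] would miss the induced
    path [c x' w]. *)
Lemma edge_C1_no_twin_y p q w : inCy x x' a b c p -> inCy x x' b a c q ->
  adj p q -> w \notin [:: x; x'; a; b; c] ->
  ~~ [&& adj w x, adj w x', ~~ adj w a, ~~ adj w b & ~~ adj w c].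
Proof.
have [[nx cx [xa xb xc] [xa' xb' xc'] _] _] := K23E hK.
case/and5P=> px /negPf px' pa /negPf pb /negPf pc.
case/and5P=> qx /negPf qx' qb /negPf qa /negPf qc pq wK.
apply/negP=> /and5P[wx wx' wa wb wc].
(* If [vw] were an edge, [x'] would be isolated from the edge [vx] among the common neighbours of
   [w] and [y]. *)
have far v y : adj x y -> adj x' y -> w != y -> ~~ adj w y -> adj v x ->
    adj v x' = false -> adj v y -> adj v w = false.
  move=> xy xy' nwy wy vx vx' vy; apply/negP=> vw.
  have P : induced_P3 x y x' by rewrite /induced_P3 ![adj y _]adjC xy xy' nx cx.
  have := nonadj_common_P3 P (etrans (adjC _ _) vw) nwy wy wx wx' vy vx.
  by rewrite vx'.
move: wK; rewrite !inE !negb_or => /and5P[_ _ nwa nwb nwc].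
have P : induced_P3 c x' w.
  by rewrite /induced_P3 xc' [adj x' w]adjC wx' eq_sym nwc adjC wc.
have := edge_meets_P3 P pq; rewrite px' pc qx' qc.
by rewrite (far p a) // (far q b).
Qed.

(** The common neighbours of [w] and [x] show that [p] and [q] do not see [w], so the edge [pq]
    would miss the induced path [x' c w]. *)
Lemma edge_C1_no_twin_x p q w : inCy x x' a b c p -> inCy x x' b a c q ->
  adj p q -> w \notin [:: x; x'; a; b; c] ->
  ~~ [&& ~~ adj w x, ~~ adj w x', adj w a, adj w b & adj w c].
Proof.
have [[nx cx [xa xb xc] [xa' xb' xc'] [nab nac nbc]] [cab cac cbc]] := K23E hK.
case/and5P=> px /negPf px' pa /negPf pb /negPf pc.
case/and5P=> qx /negPf qx' qb /negPf qa /negPf qc pq wK.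
apply/negP=> /and5P[wx wx' wa wb wc].
move: wK; rewrite !inE !negb_or => /and5P[nwx nwx' _ _ _].
have P : induced_P3 a x b by rewrite /induced_P3 xa xb nab cab.
have pw : adj p w = false.
  apply/negP=> pw; have := nonadj_common_P3 P (etrans (adjC _ _) pw) nwx wx wa wb px pa.
  by rewrite pb.
have qw : adj q w = false.
  rewrite induced_P3C in P.
  apply/negP=> qw; have := nonadj_common_P3 P (etrans (adjC _ _) qw) nwx wx wb wa qx qb.
  by rewrite qa.
have P' : induced_P3 x' c w.
  by rewrite /induced_P3 [adj c x']adjC xc' [adj c w]adjC wc eq_sym nwx' adjC wx'.
by have := edge_meets_P3 P' pq; rewrite px' pc qx' qc pw qw.
Qed.

(** Otherwise [w] is isolated from the edge [tx] among the common neighbours of the two [y]s that it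
    sees. *)
Lemma inQ_adj_dom w t : inQ x x' [:: a; b; c] w -> dom t -> adj w t.
Proof.
have [[nx cx [xa xb xc] [xa' xb' xc'] [nab nac nbc]] [cab cac cbc]] := K23E hK.
case/and3P=> wx wx' w2 /and5P[tx tx' ta tb /andP[tc _]].
have H y y' : adj x y -> adj x y' -> y != y' -> ~~ adj y y' ->
    adj t y -> adj t y' -> adj w y -> adj w y' -> adj w t.
  move=> xy xy' ny cy ty ty' wy wy'; apply: contraLR (tx) => wt.
  have := coPF (c := t) (d := w) (f := x) ny cy tx wt wx.
  by rewrite ![adj y _]adjC ![adj y' _]adjC xy xy' ty ty' wy wy'.
move: w2; rewrite /=; case wa: (adj w a); case wb: (adj w b);
  case wc: (adj w c) => //= _.
- exact: (H a b).
- exact: (H a c).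
- exact: (H b c).
Qed.

(** Otherwise [c] is isolated from the edge [pa] among the common neighbours of [w] and [x]. *)
Lemma C1_far_Q p w : inCy x x' a b c p -> ~~ adj w x -> adj w a -> adj w c ->
  ~~ adj w b -> adj p w = false.
Proof.
have [[nx cx [xa xb xc] [xa' xb' xc'] [nab nac nbc]] [cab cac cbc]] := K23E hK.
case/and5P=> px /negPf px' pa /negPf pb /negPf pc wx wa wc wb.
apply/negP=> pw; have P : induced_P3 a x c by rewrite /induced_P3 xa xc nac cac.
have nwx : w != x by apply: contraNneq wb => ->.
have := nonadj_common_P3 P (etrans (adjC _ _) pw) nwx wx wa wc px pa.
by rewrite pc.
Qed.

(* A vertex of [Q_ac] is forced to be adjacent to [q], hence so is every vertex
   complete to [K]. *)
Lemma edge_C1_dom p q w t : inCy x x' a b c p -> inCy x x' b a c q ->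
  adj p q -> inQ x x' [:: a; b; c] w -> adj w a -> adj w c -> dom t -> adj t q.
Proof.
have [[nx cx [xa xb xc] [xa' xb' xc'] [nab nac nbc]] [cab cac cbc]] := K23E hK.
move=> pC qC pq wQ wa wc tD; have wt := inQ_adj_dom wQ tD.
case/and3P: wQ => wx wx' w2; have wb : ~~ adj w b.
  by move: w2; rewrite /= wa wc; case: (adj w b).
have pw := C1_far_Q pC wx wa wc wb.
case/and5P: pC => px /negPf px' pa /negPf pb /negPf pc.
case/and5P: qC => qx /negPf qx' qb /negPf qa /negPf qc.
have P : induced_P3 w c x'.
  rewrite /induced_P3 [adj c w]adjC wc [adj c x']adjC xc' wx' andbT /=.
  by apply: contraNneq wb => ->.
have := edge_meets_P3 P pq; rewrite pc pw px' qc qx' /= orbF => qw.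
case/and5P: tD => tx tx' ta tb /andP[tc _].
have nqt : q != t by apply: contraTneq tx' => <-; rewrite qx'.
apply: contraLR qw => tq; rewrite adjC in tq.
have := coPF (c := x) (d := w) (f := b) nqt tq xb wx wb.
by rewrite qx qb tx tb [adj t w]adjC wt; case: (adj q w).
Qed.

Section Triangle.

Variables p q r : G.
Hypotheses (pC : inCy x x' a b c p) (qC : inCy x x' b a c q).
Hypotheses (rC : inCy x x' c a b r).
Hypotheses (pq : adj p q) (pr : adj p r) (qr : adj q r).

(** If [ps] is not an edge, the paths [s x' c] and [s x' b] force [s] to see [q] and [r]; then [a]
    is isolated from the edge [qr] among the common neighbours of [p] and [s]. *)
Lemma triangle_matched s : inCy x' x a b c s -> adj p s.
Proof.
have [[nx cx [xa xb xc] [xa' xb' xc'] _] _] := K23E hK.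
case/and5P: pC => px /negPf px' pa /negPf pb /negPf pc.
case/and5P: qC => qx /negPf qx' qb /negPf qa /negPf qc.
case/and5P: rC => rx /negPf rx' rc /negPf ra /negPf rb.
case/and5P=> sx' /negPf sx sa /negPf sb /negPf sc.
apply/negPn/negP=> ps.
have P y : adj x y -> adj x' y -> adj s y = false -> induced_P3 s x' y.
  move=> xy xy' sy; rewrite /induced_P3 [adj x' s]adjC sx' xy' sy andbT /=.
  by apply: contraFneq sx => ->; rewrite adjC.
have := edge_meets_P3 (P c xc xc' sc) pq; rewrite px' pc qx' qc (negPf ps) /= orbF.
have := edge_meets_P3 (P b xb xb' sb) pr; rewrite px' pb rx' rb (negPf ps) /= orbF.
move=> rs qs; have nps : p != s by apply: contraTneq px => ->; rewrite sx.
have := coPF (c := q) (d := a) (f := r) nps ps qr.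
rewrite ![adj a _]adjC qa ra => /(_ isT isT).
by rewrite pq pa pr ![adj s _]adjC qs rs [adj a s]adjC sa.
Qed.

(** Otherwise [a] is isolated from the edge [qr] among the common neighbours of [t] and [p]. *)
Lemma triangle_dom t : dom t -> adj t q -> adj t r -> adj t p.
Proof.
case/and5P=> tx tx' ta tb _ tq tr; apply/negPn/negP=> tp.
case/and5P: pC => px px' pa _ _.
case/and5P: qC => _ _ _ qa _; case/and5P: rC => _ _ _ ra _.
have ntp : t != p by apply: contraTneq tx' => ->.
have := coPF (c := q) (d := a) (f := r) ntp tp qr.
rewrite ![adj a _]adjC qa ra => /(_ isT isT).
by rewrite tq ta tr pq pa pr.
Qed.

End Triangle.

(** The edge [ps] must meet the induced path [b t c], and sees neither [b] nor [c]. *)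
Lemma matched_dom p s t : inCy x x' a b c p -> inCy x' x a b c s -> adj p s ->
  dom t -> adj t p || adj t s.
Proof.
have [[_ _ _ _ [_ _ nbc]] [_ _ cbc]] := K23E hK.
case/and5P=> _ _ _ /negPf pb /negPf pc.
case/and5P=> _ _ _ /negPf sb /negPf sc ps /and5P[_ _ _ tb /andP[tc _]].
have P : induced_P3 b t c by rewrite /induced_P3 tb tc nbc.
have := edge_meets_P3 P ps; rewrite pb pc sb sc.
by rewrite ![adj t _]adjC /= !orbF.
Qed.

(** Otherwise [s] is isolated from the edge [x t'] among the common neighbours of [t] and [p]. *)
Lemma matched_dom_pair p s t t' : inCy x x' a b c p -> inCy x' x a b c s ->
  adj p s -> dom t -> dom t' -> adj t t' -> ~~ adj t p -> adj t s ->
  adj t' p -> adj t' s.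
Proof.
case/and5P=> px px' pa pb pc /and5P[sx' sx sa sb sc] ps.
case/and5P=> tx tx' ta tb _ /and5P[ux ux' ua ub _] tu tp ts up.
apply/negPn/negP=> us; have ntp : t != p by apply: contraTneq tx' => ->.
have := coPF (c := x) (d := s) (f := t') ntp tp.
rewrite [adj x t']adjC ux sx [adj s t']adjC us tx ts tu px ps [adj p t']adjC up.
by move/(_ isT isT isT).
Qed.

End Structure.

(** * The case without slack in the clique number *)

(** The last clause holds when no clique exceeds [#|T| + 2]: a triangle complete to the clique [T]
    would add three vertices. *)
Definition tight (K : seq G) (T : {set G}) : Prop :=
  [/\ forall t, t \in T -> all (adj t) K,
      {in T &, forall s t, s != t -> adj s t}
    & forall u v w, adj u v -> adj u w -> adj v w ->
        exists2 t, t \in T & ~~ [&& adj t u, adj t v & adj t w]].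

Lemma perm_tight K K' T : perm_eq K K' -> tight K T -> tight K' T.
Proof.
by move=> p [h1 h2 h3]; split=> // t /h1; rewrite (perm_all _ p).
Qed.

Lemma inQC (x x' : G) Y v : inQ x x' Y v = inQ x' x Y v.
Proof. by rewrite /inQ andbCA. Qed.

Lemma perm_inQ (x x' : G) Y Y' v : perm_eq Y Y' -> inQ x x' Y v = inQ x x' Y' v.
Proof. by move=> p; rewrite /inQ (permP p). Qed.

(** Two vertices of [Q] share a [y]; if adjacent, they form with it a triangle complete to [T], by
    [inQ_adj_dom]. *)
Lemma tight_inQ_indep (x x' a b c : G) T : K23 x x' [:: a; b; c] ->
  tight [:: x; x'; a; b; c] T ->
  forall u v, inQ x x' [:: a; b; c] u -> inQ x x' [:: a; b; c] v -> ~~ adj u v.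
Proof.
move=> hK [hT _ tri] u v uQ vQ; apply/negP=> uv.
have no y : y \in [:: a; b; c] -> adj u y -> adj v y -> False.
  move=> yY uy vy; have [t tT /negP[]] := tri u v y uv uy vy.
  have tK := hT t tT.
  rewrite adjC (inQ_adj_dom hK uQ tK) adjC (inQ_adj_dom hK vQ tK) /=.
  by apply: (allP tK); rewrite 2!inE yY !orbT.
case/and3P: uQ vQ => _ _ + /and3P[_ _]; rewrite /=.
have := no a; have := no b; have := no c; rewrite !inE !eqxx !orbT.
case: (adj u a); case: (adj u b); case: (adj u c) => //=;
case: (adj v a); case: (adj v b); case: (adj v c) => //=; tauto.
Qed.

(* The configuration forced by an edge inside [inC x x'] when there is no slack:
   only [x] and [x'] ([a], [b], [c]) have their adjacencies to [K], and [Q_bc]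
   is empty. *)
Definition slim (x x' a b c : G) : Prop :=
  [/\ forall w, w \notin [:: x; x'; a; b; c] -> ~~ [&& adj w x, adj w x',
        ~~ adj w a, ~~ adj w b & ~~ adj w c],
      forall w, w \notin [:: x; x'; a; b; c] -> ~~ [&& ~~ adj w x, ~~ adj w x',
        adj w a, adj w b & adj w c]
    & forall w, ~~ [&& inQ x x' [:: a; b; c] w, adj w b & adj w c]].

Lemma perm_swap12 (T : eqType) (y z : T) s : perm_eq (y :: z :: s) (z :: y :: s).
Proof. by apply/permPl; apply: (perm_catCA [:: y] [:: z] s). Qed.

Lemma slimC (x x' a b c : G) : slim x x' a b c -> slim x' x a b c.
Proof.
case=> h1 h2 h3; split=> w.
- by rewrite (perm_mem (perm_swap12 _ _ _)) andbCA => /h1.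
- by rewrite (perm_mem (perm_swap12 _ _ _)) andbCA => /h2.
- by rewrite inQC.
Qed.

Lemma edge_C1_slim (x x' y1 y2 y3 u v : G) T :
    K23 x x' [:: y1; y2; y3] -> tight [:: x; x'; y1; y2; y3] T ->
    inC x x' u -> inC x x' v -> adj u v ->
  exists a b c, perm_eq [:: a; b; c] [:: y1; y2; y3] /\ slim x x' a b c.
Proof.
move=> hK hT uC vC uv; have [a [b [c [p ua vb]]]] := C1_edgeP hK uC vC uv.
rewrite -(perm_K23 _ _ p) in hK.
have {}hT : tight [:: x; x'; a; b; c] T.
  by apply: perm_tight hT; rewrite !perm_cons perm_sym.
have hE w := edge_C1_no_twin_y hK (w := w) ua vb uv.
have hX w := edge_C1_no_twin_x hK (w := w) ua vb uv.
case: (boolP [exists w, [&& inQ x x' [:: a; b; c] w, adj w b & adj w c]]).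
  (* Here [Q_bc] is inhabited, so [a] and [b] are exchanged and [Q_ac] is shown empty. *)
  case/existsP=> w /and3P[wQ wb wc]; exists b, a, c.
  have pba := perm_swap12 b a [:: c].
  have vu : adj v u by rewrite adjC.
  have hK' := hK; rewrite -(perm_K23 _ _ pba) in hK'.
  have tK t : t \in T -> all (adj t) [:: x; x'; a; b; c] by case: hT => h _ _; apply: h.
  have tK' t : t \in T -> all (adj t) [:: x; x'; b; a; c].
    by move/tK; rewrite (@perm_all _ _ [:: x; x'; b; a; c]) // !perm_cons perm_swap12.
  split; first exact: perm_trans p.
  split=> [z|z|z].
  - rewrite (@perm_mem _ _ [:: x; x'; a; b; c]) ?perm_cons // => /hE.
    by apply: contra => /and5P[-> -> -> -> ->].
  - rewrite (@perm_mem _ _ [:: x; x'; a; b; c]) ?perm_cons // => /hX.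
    by apply: contra => /and5P[-> -> -> -> ->].
  (* Were both inhabited, [edge_C1_dom] would make the triangle [u v x] complete to [T]. *)
  apply/negP=> /and3P[zQ za zc]; case: hT => _ _ tri.
  have [ux vx] : adj u x /\ adj v x by case/andP: uC; case/andP: vC.
  have [t tT /negP[]] := tri u v x uv ux vx.
  rewrite (perm_inQ _ _ _ pba) in zQ.
  rewrite (edge_C1_dom hK ua vb uv zQ za zc (tK t tT)).
  rewrite -(perm_inQ _ _ _ pba) in wQ.
  rewrite (edge_C1_dom hK' vb ua vu wQ wb wc (tK' t tT)).
  by case/andP: (tK t tT).
move/existsPn=> nQ; exists a, b, c; split=> //.
Qed.

Lemma inCy_swap (x x' a b c v : G) : inCy x x' a b c v -> inCy x x' a c b v.
Proof. by rewrite /inCy [~~ adj v b && _]andbC. Qed.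

(** Some [t] in [T] misses a vertex [pi]. By [triangle_dom] it misses two, by [matched_dom] it sees
    the matching [qi], hence all three. Symmetrically some [s] misses a [qi] and sees every [pi];
    [matched_dom_pair] then makes [s] see two of the [qi], hence all. *)
Lemma tight_no_two_triangles (x x' a b c p1 p2 p3 q1 q2 q3 : G) T :
  K23 x x' [:: a; b; c] -> tight [:: x; x'; a; b; c] T ->
  inCy x x' a b c p1 -> inCy x x' b a c p2 -> inCy x x' c a b p3 ->
  adj p1 p2 -> adj p1 p3 -> adj p2 p3 ->
  inCy x' x a b c q1 -> inCy x' x b a c q2 -> inCy x' x c a b q3 ->
  adj q1 q2 -> adj q1 q3 -> adj q2 q3 -> False.
Proof.
move=> hK [tD tC tri] p1C p2C p3C p12 p13 p23 q1C q2C q3C q12 q13 q23.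
have pm2 : perm_eq [:: b; a; c] [:: a; b; c] by rewrite perm_swap12.
have pm3 : perm_eq [:: c; a; b] [:: a; b; c].
  by apply/permPl; apply: (perm_catC [:: c] [:: a; b]).
have hK2 : K23 x x' [:: b; a; c] by rewrite (perm_K23 _ _ pm2).
have hK3 : K23 x x' [:: c; a; b] by rewrite (perm_K23 _ _ pm3).
have tD2 t : t \in T -> all (adj t) [:: x; x'; b; a; c].
  by move/tD; rewrite (@perm_all _ _ [:: x; x'; b; a; c]) // !perm_cons perm_sym.
have tD3 t : t \in T -> all (adj t) [:: x; x'; c; a; b].
  by move/tD; rewrite (@perm_all _ _ [:: x; x'; c; a; b]) // !perm_cons perm_sym.
have tC1 t : t \in T -> all (adj t) [:: x'; x; a; b; c].
  by move/tD; rewrite (perm_all _ (perm_swap12 _ _ _)).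
have tC2 t : t \in T -> all (adj t) [:: x'; x; b; a; c].
  by move/tD2; rewrite (perm_all _ (perm_swap12 _ _ _)).
have tC3 t : t \in T -> all (adj t) [:: x'; x; c; a; b].
  by move/tD3; rewrite (perm_all _ (perm_swap12 _ _ _)).
have [p21 p31 p32] : [/\ adj p2 p1, adj p3 p1 & adj p3 p2].
  by rewrite ![adj _ p1]adjC [adj p3 _]adjC.
have [q21 q31 q32] : [/\ adj q2 q1, adj q3 q1 & adj q3 q2].
  by rewrite ![adj _ q1]adjC [adj q3 _]adjC.
have m1 : adj p1 q1 := triangle_matched hK p1C p2C p3C p12 p13 p23 q1C.
have m2 : adj p2 q2.
  exact: (triangle_matched hK2 p2C p1C (inCy_swap p3C) p21 p23 p13 q2C).
have m3 : adj p3 q3.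
  exact: (triangle_matched hK3 p3C (inCy_swap p1C) (inCy_swap p2C)
    p31 p32 p12 q3C).
have domp t : t \in T -> [&& adj t p2 && adj t p3 ==> adj t p1,
    adj t p1 && adj t p3 ==> adj t p2 & adj t p1 && adj t p2 ==> adj t p3].
  move=> tT; apply/and3P; split; apply/implyP=> /andP[].
  - exact: (triangle_dom p1C p2C p3C p12 p13 p23 (tD t tT)).
  - exact: (triangle_dom p2C p1C (inCy_swap p3C) p21 p23 p13 (tD2 t tT)).
  - exact: (triangle_dom p3C (inCy_swap p1C) (inCy_swap p2C) p31 p32 p12
      (tD3 t tT)).
have domq t : t \in T -> [&& adj t q2 && adj t q3 ==> adj t q1,
    adj t q1 && adj t q3 ==> adj t q2 & adj t q1 && adj t q2 ==> adj t q3].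
  move=> tT; apply/and3P; split; apply/implyP=> /andP[].
  - exact: (triangle_dom q1C q2C q3C q12 q13 q23 (tC1 t tT)).
  - exact: (triangle_dom q2C q1C (inCy_swap q3C) q21 q23 q13 (tC2 t tT)).
  - exact: (triangle_dom q3C (inCy_swap q1C) (inCy_swap q2C) q31 q32 q12
      (tC3 t tT)).
have dom1 t : t \in T -> [&& adj t p1 || adj t q1, adj t p2 || adj t q2
    & adj t p3 || adj t q3].
  move=> tT; rewrite (matched_dom hK p1C q1C m1 (tD t tT)).
  rewrite (matched_dom hK2 p2C q2C m2 (tD2 t tT)).
  by rewrite (matched_dom hK3 p3C q3C m3 (tD3 t tT)).
have [t tT tp] := tri _ _ _ p12 p13 p23.
have [s sT sq] := tri _ _ _ q12 q13 q23.
have nts : t != s.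
  apply: contraNneq sq => <-; move: tp (dom1 t tT) (domp t tT) (domq t tT).
  by clear; adj_cases.
have ts := tC t s tT sT nts.
have M1 : [&& ~~ adj t p1, adj t q1 & adj s p1] ==> adj s q1.
  apply/implyP=> /and3P[].
  exact: (matched_dom_pair p1C q1C m1 (tD t tT) (tD s sT) ts).
have M2 : [&& ~~ adj t p2, adj t q2 & adj s p2] ==> adj s q2.
  apply/implyP=> /and3P[].
  exact: (matched_dom_pair p2C q2C m2 (tD2 t tT) (tD2 s sT) ts).
have M3 : [&& ~~ adj t p3, adj t q3 & adj s p3] ==> adj s q3.
  apply/implyP=> /and3P[].
  exact: (matched_dom_pair p3C q3C m3 (tD3 t tT) (tD3 s sT) ts).
move: M1 M2 M3 tp sq (dom1 t tT) (domp t tT) (domq t tT).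
by move: (dom1 s sT) (domp s sT) (domq s sT); clear; adj_cases.
Qed.

Lemma tight_color5 (x1 x2 y1 y2 y3 : G) T :
    K23 x1 x2 [:: y1; y2; y3] -> tight [:: x1; x2; y1; y2; y3] T ->
  exists f : G -> nat, forall u v,
    ~~ all (adj u) [:: x1; x2; y1; y2; y3] ->
    ~~ all (adj v) [:: x1; x2; y1; y2; y3] ->
    (f u < 5) /\ (adj u v -> f u != f v).
Proof.
move=> hK hT; have hK' := K23C hK.
have hT' := perm_tight (perm_swap12 _ _ _) hT.
pose E (x x' : G) := [exists u, exists v, [&& inC x x' u, inC x x' v & adj u v]].
have nE x x' : ~~ E x x' -> forall u v, inC x x' u -> inC x x' v -> ~~ adj u v.
  move=> /existsPn nE u v uC vC; move/existsPn: (nE u) => /(_ v).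
  by rewrite uC vC.
have [slim12|noE] : (exists a b c, perm_eq [:: a; b; c] [:: y1; y2; y3]
    /\ slim x1 x2 a b c) \/ (~~ E x1 x2 /\ ~~ E x2 x1).
  case: (boolP (E x1 x2)) => [/existsP[u /existsP[v /and3P[uC vC uv]]]|n1].
    by left; apply: edge_C1_slim hK hT uC vC uv.
  case: (boolP (E x2 x1)) => [/existsP[u /existsP[v /and3P[uC vC uv]]]|n2].
    left; have [a [b [c [p /slimC s]]]] := edge_C1_slim hK' hT' uC vC uv.
    by exists a, b, c.
  by right.
2: by case: noE => /nE n1 /nE n2; apply: color5_ex => //; apply: tight_inQ_indep hT.
have [a [b [c [p sl]]]] := slim12.
(* Stated for both orders of the [x]s, since either [C1] or [C2] may be the bipartite class. *)
have half x x' (h : G -> bool) : K23 x x' [:: y1; y2; y3] ->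
    perm_eq [:: x; x'] [:: x1; x2] -> slim x x' a b c ->
    (forall u v, inC x x' u -> inC x x' v -> adj u v -> h u != h v) ->
  exists f : G -> nat, forall u v,
    ~~ all (adj u) [:: x1; x2; y1; y2; y3] ->
    ~~ all (adj v) [:: x1; x2; y1; y2; y3] ->
    (f u < 5) /\ (adj u v -> f u != f v).
  rewrite -(perm_K23 _ _ p) => hKx px [hE hX hQ] hh.
  have pK : perm_eq [:: x; x'; a; b; c] [:: x1; x2; y1; y2; y3].
    exact: (perm_cat px p).
  have hTx : tight [:: x; x'; a; b; c] T.
    by apply: perm_tight hT; rewrite perm_sym.
  have [f fP] := color5h_ex hKx hh (tight_inQ_indep hKx hTx) hE hX hQ.
  by exists f => u v; rewrite -!(perm_all _ pK); apply: fP.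
pose tri (x x' : G) := [exists u, exists v, exists w, [&& inC x x' u, inC x x' v,
  inC x x' w, adj u v, adj u w & adj v w]].
have bip x x' : K23 x x' [:: y1; y2; y3] -> ~~ tri x x' -> exists h : G -> bool,
    forall u v, inC x x' u -> inC x x' v -> adj u v -> h u != h v.
  move=> hKx /existsPn nT; apply: (C1_bipartite hKx) => u v w uC vC wC uv uw.
  have /existsPn/(_ v)/existsPn/(_ w) := nT u.
  by rewrite uC vC wC uv uw.
have trP x x' : K23 x x' [:: y1; y2; y3] -> tri x x' ->
  exists p q r, [/\ inCy x x' y1 y2 y3 p, inCy x x' y2 y1 y3 q,
    inCy x x' y3 y1 y2 r & [/\ adj p q, adj p r & adj q r]].
  move=> hKx /existsP[u /existsP[v /existsP[w /and5P[uC vC wC uv /andP[uw vw]]]]].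
  exact: (C1_triangleP hKx uC vC wC).
case: (boolP (tri x1 x2)) => [t12|/(bip _ _ hK)[h hh]]; last first.
  exact: (half x1 x2 h).
case: (boolP (tri x2 x1)) => [t21|/(bip _ _ hK')[h hh]]; last first.
  by apply: (half x2 x1 h) => //; [rewrite perm_swap12 | apply: slimC].
have [p1 [p2 [p3 [p1C p2C p3C [p12 p13 p23]]]]] := trP _ _ hK t12.
have [q1 [q2 [q3 [q1C q2C q3C [q12 q13 q23]]]]] := trP _ _ hK' t21.
by case: (tight_no_two_triangles hK hT p1C p2C p3C p12 p13 p23 q1C q2C q3C).
Qed.

End Free.

(** * Cliques and colourings of the whole graph *)

Lemma cliqueP (G : sgraph) (A : {set G}) :
  reflect {in A &, forall u v, u != v -> adj u v} (is_clique A).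
Proof.
apply: (iffP forall_inP) => [Acl u v uA vA|Acl u uA].
  by move/forall_inP: (Acl u uA) => /(_ v vA)/implyP.
by apply/forall_inP=> v vA; apply/implyP; apply: Acl.
Qed.

Lemma clique_number_ge (G : sgraph) (A : {set G}) (s : seq G) :
  is_clique A -> pairwise (@adj G) s ->
  (forall v t, v \in s -> t \in A -> adj v t) ->
  #|A| + size s <= clique_number G.
Proof.
elim: s A => [|v s IHs] A Acl /=; first by rewrite addn0 => _ _; apply: leq_bigmax_cond.
case/andP=> /allP vs ps sA.
have vA t : t \in A -> adj v t by apply: sA; rewrite mem_head.
rewrite addnS -addSn; suff <- : #|v |: A| = #|A|.+1.
  apply: IHs => // [|u t us /setU1P[->|tA]].
  - apply/cliqueP=> a b /setU1P[->|aA] /setU1P[->|bA]; rewrite ?eqxx //.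
    + by move=> _; apply: vA.
    + by move=> _; rewrite adjC vA.
    + exact: (cliqueP _ Acl).
  - by rewrite adjC vs.
  - by apply: sA; rewrite // inE us orbT.
rewrite cardsU1; suff -> : v \notin A by [].
by apply/negP=> /vA; rewrite adj_irrefl.
Qed.

Lemma chromatic_number_le (G : sgraph) (n : nat) (f : G -> nat) :
  (forall v, f v < n) -> (forall u v, adj u v -> f u != f v) ->
  chromatic_number G <= n.
Proof.
move=> fn fP; rewrite /chromatic_number; case: ex_minnP => m _; apply.
apply/existsP; exists [ffun v => Ordinal (fn v)].
apply/forallP=> u; apply/forallP=> v; apply/implyP=> /fP.
by rewrite !ffunE -val_eqE.
Qed.

(* Nonadjacency is an equivalence relation on [T], so a system of
   representatives of its classes is a clique that indexes a colouring. *)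
Lemma multipartite_transversal (G : sgraph) (T : {set G}) :
    {in T & &, forall u v w, ~~ adj u v -> ~~ adj v w -> ~~ adj u w} ->
  exists2 r : G -> G, is_clique (r @: T) /\ r @: T \subset T
    & {in T &, forall u v, adj u v -> r u != r v}.
Proof.
move=> trT; pose r u := odflt u [pick s in T | ~~ adj s u].
have rP u : u \in T -> (r u \in T) && ~~ adj (r u) u.
  rewrite /r => uT; case: pickP => [s //|/(_ u)].
  by rewrite /= uT adj_irrefl.
have rE : {in T &, forall u v, ~~ adj u v -> r u = r v}.
  move=> u v uT vT uv; rewrite /r.
  have E : [pred s | (s \in T) && ~~ adj s u] =1 [pred s | (s \in T) && ~~ adj s v].
    move=> s /=; case sT: (s \in T) => //=; apply/idP/idP => h.
      exact: trT uv.
    by apply: trT h _ => //; rewrite adjC.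
  by rewrite (eq_pick E); case: pickP => // /(_ v); rewrite /= vT adj_irrefl.
exists r; first split.
- apply/cliqueP=> _ _ /imsetP[u uT ->] /imsetP[v vT ->].
  have [/andP[ruT ru] /andP[rvT rv]] := (rP u uT, rP v vT).
  apply: contraNT => nr; rewrite (rE u v) //.
  rewrite adjC in ru; exact: trT (trT _ _ _ uT ruT rvT ru nr) rv.
- by apply/subsetP=> _ /imsetP[u uT ->]; case/andP: (rP u uT).
move=> u v uT vT; apply: contraL => /eqP e.
have [/andP[ruT ru] /andP[rvT rv]] := (rP u uT, rP v vT).
by rewrite adjC in ru; apply: trT ru _ => //; rewrite e.
Qed.

Theorem theorem3p1 (G : sgraph)
    (hfree : ~ has_induced (disjoint_union (path_graph 2) (path_graph 3)) G)
    (hcofree :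
       ~ has_induced (compl (disjoint_union (path_graph 2) (path_graph 3))) G)
    (hK23 : has_induced (complete_bipartite 2 3) G) :
  chromatic_number G <= clique_number G + 3.
Proof.
have [PF coPF] := (P2P3_freeP hfree, coP2P3_freeP hcofree).
have [x1 [x2 [y1 [y2 [y3 hK]]]]] : exists x1 x2 y1 y2 y3 : G,
    K23 x1 x2 [:: y1; y2; y3].
  case: hK23 => f f_inj fE.
  exists (f (inl (@Ordinal 2 0 isT))), (f (inl (@Ordinal 2 1 isT))).
  exists (f (inr (@Ordinal 3 0 isT))), (f (inr (@Ordinal 3 1 isT))).
  exists (f (inr (@Ordinal 3 2 isT))).
  by rewrite /K23 /allrel /= !inE !fE !(inj_eq f_inj).
pose K := [:: x1; x2; y1; y2; y3].
pose T : {set G} := [set t | all (adj t) K].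
have [[nx cx [a1 a2 a3] [b1 b2 b3] _] _] := K23E hK.
(* Otherwise [v] is isolated from the edge [uw] among the common neighbours of [x1] and [x2]. *)
have trT : {in T & &, forall u v w, ~~ adj u v -> ~~ adj v w -> ~~ adj u w}.
  move=> u v w; rewrite !inE => /and3P[u1 u2 _] /and3P[v1 v2 _] /and3P[w1 w2 _].
  move=> uv vw; apply/negP=> uw; rewrite adjC in uv.
  have := coPF _ _ _ _ _ nx cx uw uv vw.
  by rewrite ![adj x1 _]adjC ![adj x2 _]adjC u1 u2 v1 v2 w1 w2.
have [r [Tcl /subsetP rT] rP] := multipartite_transversal trT.
set T0 := r @: T in Tcl rT.
have TK t : t \in T0 -> all (adj t) K by move/rT; rewrite inE.
have combine n (f : G -> nat) :
    (forall u v, ~~ all (adj u) K -> ~~ all (adj v) K ->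
      (f u < n) /\ (adj u v -> f u != f v)) ->
  chromatic_number G <= #|T0| + n.
  (* The first [#|T0|] colours go to [T] through its representatives, the next [n] to the remaining
     vertices. *)
  move=> fP; pose c v := if v \in T then index (r v) (enum T0) else #|T0| + f v.
  have cT v : v \in T -> index (r v) (enum T0) < #|T0|.
    by move=> vT; rewrite cardE index_mem mem_enum imset_f.
  apply: (@chromatic_number_le G _ c) => [v|u v uv]; rewrite /c.
    case: ifP => [vT|]; first by apply: leq_trans (cT v vT) (leq_addr _ _).
    by rewrite inE => /negbT vT; rewrite ltn_add2l; case: (fP v v vT vT).
  case: ifP => uT; case: ifP => vT.
  - apply: contraNneq (rP u v uT vT uv) => e.
    by rewrite -(nth_index u (_ : r u \in enum T0)) ?e ?nth_index
        ?mem_enum ?imset_f.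
  - by rewrite neq_ltn (leq_trans (cT u uT) (leq_addr _ _)).
  - by rewrite neq_ltn (leq_trans (cT v vT) (leq_addr _ _)) orbT.
  - rewrite eqn_add2l; move: uT vT; rewrite !inE => /negbT uT /negbT vT.
    by case: (fP u v uT vT) => _; apply.
have lbT : #|T0| + 2 <= clique_number G.
  apply: (@clique_number_ge _ T0 [:: x1; y1]); rewrite //= ?a1 // => v t + /TK tK.
  by rewrite adjC; move: v; apply/allP; move: tK; rewrite /= => /and3P[-> _ /andP[->]].
have [le3|lt3] := leqP (#|T0| + 3) (clique_number G).
  have [f /combine le6] := color6_ex PF coPF hK.
  by apply: leq_trans le6 _; rewrite -[6]/(3 + 3) addnA leq_add2r.
(* The clique number is now below [#|T0| + 3], which rules out a triangle complete to [T0]. *)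
have hT : tight K T0.
  split=> // [|u v w uv uw vw]; first exact: (cliqueP _ Tcl).
  apply/exists_inP; apply: contraLR lt3 => /exists_inPn nt; rewrite -leqNgt.
  apply: (@clique_number_ge _ T0 [:: u; v; w]); rewrite //= ?uv ?uw ?vw // => z t + tT.
  rewrite adjC; move: z; apply/allP; move: (nt t tT).
  by rewrite negbK /= andbT.
have [f /combine le5] := tight_color5 PF coPF hK hT.
by apply: leq_trans le5 _; rewrite -[5]/(2 + 3) addnA leq_add2r.
Qed.
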